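(* Let $J=a_0(x)I+a_1(x)D+\frac{a_2(x)}{2}D^2+\frac{a_3(x)}{3!}D^3$ be a differential operator on $\mathcal P$, where $a_0(x)=a_0^{[0]}$, $a_1(x)=a_0^{[1]}+a_1^{[1]}x$, $a_2(x)=a_0^{[2]}+a_1^{[2]}x+a_2^{[2]}x^2$, $a_3(x)=a_0^{[3]}+a_1^{[3]}x+a_2^{[3]}x^2+a_3^{[3]}x^3$ have complex coefficients, and assume that $J$ is an isomorphism of $\mathcal P$, i.e. $\lambda_n^{[0]}:=\sum_{\mu=0}^{n}\binom{n}{\mu}a_\mu^{[\mu]}\neq 0$ for all $n\ge 0$ (with $a_\mu^{[\mu]}=0$ for $\mu\ge 4$). Let $\{P_n(x)\}_{n\ge 0}$ be a $2$-orthogonal monic polynomial sequence, with recurrence coefficients $\{\beta_n\}_{n\ge0}$, $\{\alpha_n\}_{n\ge1}$, $\{\gamma_n\}_{n\ge1}$ and dual sequence $\{u_n\}_{n\ge0}$, such that $\alpha_4=\dfrac{\alpha_2\gamma_3}{\gamma_2}$ and $J(P_n(x))=\lambda_n^{[0]}P_n(x)$ for all $n\ge 0$. Suppose that $$a_3(x)=\tau\,a_2(x)\ \text{ for some constant }\tau\neq0,\qquad a_1(x)=-\frac{1}{3\gamma_1}(x-\beta_0),\qquad \deg(a_2(x))\le 1,$$ $$a_1^{[2]}\neq\frac{2\tau}{\gamma_1(m+1)}-\frac{2}{3\gamma_1}(\beta_1-\beta_3)\ \text{ for all integers } m\ge0.$$ Then $\{P_n(x)\}_{n\ge0}$ is classical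 in Hahn's sense, and the regular vector functional $U=(u_0,u_1)^T$ satisfies $$D\left(\Phi(x)U\right)+\Psi(x)U=0,$$ where $$\Psi(x)=\begin{bmatrix}0&1\\ 2E_1(x)&2A_0(x)\end{bmatrix},\quad E_1(x)=\frac{1}{\gamma_1}(x-\beta_0),\quad A_0(x)=-\frac{\alpha_1}{\gamma_1},\qquad \Phi(x)=\begin{bmatrix}\varpi_{1,1}(x)&\varpi_{1,2}(x)\\ \varpi_{2,1}(x)&\varpi_{2,2}(x)\end{bmatrix},$$ with $$\varpi_{1,1}(x)=\frac{3\beta_0\gamma_2+\alpha_2\beta_0\left(\beta_1+\beta_2-2(\beta_3+\tau)\right)+\gamma_1\left(-2\beta_0-3\beta_1+2\beta_3+6\tau\right)}{6\gamma_1\tau}+\frac{3(\gamma_1-\gamma_2)-\alpha_2\left(\beta_1+\beta_2-2(\beta_3+\tau)\right)}{6\gamma_1\tau}\,x,$$ $$\varpi_{1,2}(x)=\frac{\gamma_1\left(3\gamma_1a_0^{[2]}-2\left(\alpha_2+2\beta_0\tau+\beta_1(\beta_1-\beta_3-2\tau)\right)\right)+\alpha_1\left(-\gamma_1+3\gamma_2+\alpha_2\left(\beta_1+\beta_2-2(\beta_3+\tau)\right)\right)}{6\gamma_1\tau}+\frac{3\gamma_1a_1^{[2]}+2\beta_1-2\beta_3}{6\tau}\,x,$$ $$\varpi_{2,1}(x)=\frac{1}{9\gamma_1^2\gamma_2\tau}\Big[-3\alpha_1\beta_0\gamma_2^2+\gamma_2\gamma_1\left(\alpha_1\left(2\beta_0-2\beta_3+3(\beta_1+\tau)\right)+6\beta_0(\beta_0-\beta_2)\tau\right)+\alpha_2\beta_0\left(3\alpha_3\gamma_1\tau-\alpha_1\gamma_2(\beta_1+\beta_2-2\beta_3+\tau)\right)-3\alpha_3\gamma_1^2\tau\Big]$$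 $$\qquad+\frac{\alpha_2\left(\alpha_1\gamma_2(\beta_1+\beta_2-2\beta_3+\tau)-3\alpha_3\gamma_1\tau\right)+3\gamma_2\left(\alpha_1(\gamma_2-\gamma_1)+2(\beta_2-\beta_0)\gamma_1\tau\right)}{9\gamma_1^2\gamma_2\tau}\,x,$$ $$\varpi_{2,2}(x)=\frac{1}{9\gamma_1^2\gamma_2\tau}\Big[\alpha_1\gamma_1\Big(\gamma_2\big(-3\gamma_1a_0^{[2]}+7\beta_0\tau+2(\beta_1^2+\beta_1(\tau-\beta_3)-3\beta_2\tau)\big)+\alpha_2(2\gamma_2+3\alpha_3\tau)\Big)$$ $$\qquad-\alpha_1^2\gamma_2\big(-\gamma_1+3\gamma_2+\alpha_2(\beta_1+\beta_2-2\beta_3+\tau)\big)-3\gamma_1^2\tau(\alpha_3\beta_1-3\gamma_2)\Big]+\frac{3\alpha_3\gamma_1\tau-\alpha_1\gamma_2\left(3\gamma_1a_1^{[2]}+2\beta_1-2\beta_3+3\tau\right)}{9\gamma_1\gamma_2\tau}\,x.$$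
   Context: $\mathcal P$ is the vector space of polynomials in one variable with complex coefficients, $\mathcal P'$ its dual space, $\langle u,p\rangle$ the action of $u\in\mathcal P'$ on $p\in\mathcal P$. $D$ is the usual derivative on $\mathcal P$; on $\mathcal P'$, $\langle Du,p\rangle=-\langle u,p'\rangle$, and for a polynomial $\varpi$ the form $\varpi u$ is defined by $\langle\varpi u,p\rangle=\langle u,\varpi p\rangle$. On vectors of forms, $D$ acts componentwise, and a polynomial matrix times a vector of forms is the usual matrix-vector product using left-multiplication. A monic polynomial sequence (MPS) is a sequence $\{P_n\}_{n\ge0}$ of monic polynomials with $\deg P_n=n$. Its dual sequence $\{u_n\}_{n\ge0}\subset\mathcal P'$ is the unique sequence with $\langle u_n,P_m\rangle=\delta_{n,m}$. The MPS is $2$-orthogonal (with respect to $U=(u_0,u_1)$, in which case $U$ is called regular) if for $\nu=0,1$ and all $m\ge0$: $\langle u_\nu,P_mP_n\rangle=0$ for $n\ge 2m+\nu+1$ and $\langle u_\nu,P_mP_{2m+\nu}\rangle\ne0$. Equivalently, there are complex constants $\{\beta_n\}_{n\ge0}$, $\{\alpha_n\}_{n\ge1}$, $\{\gamma_n\}_{n\ge1}$ with $\gamma_{n+1}\neq0$ for $n\ge0$ such that $P_0=1$, $P_1=x-\beta_0$, $P_2=(x-\beta_1)P_1-\alpha_1$, and $P_{n+3}=(x-\beta_{n+2})P_{n+2}-\alpha_{n+2}P_{n+1}-\gamma_{n+1}P_n$ for $n\ge0$; these are the recurrence coefficients. A $2$-orthogonal MPS $\{P_n\}_{n\ge0}$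 is classical in Hahn's sense if the MPS $\{(n+1)^{-1}DP_{n+1}(x)\}_{n\ge0}$ is also $2$-orthogonal. *)

(* Defs.v *)
From HB Require Import structures.
From mathcomp Require Import all_boot all_order all_algebra.
From mathcomp Require Import ring.

Set Implicit Arguments.
Unset Strict Implicit.
Unset Printing Implicit Defensive.

Import Order.TTheory GRing.Theory Num.Theory.
Local Open Scope ring_scope.

Notation poly_dual F := {scalar {poly F}}.

Section Forms.
Variable F : numFieldType.
Implicit Types (u : poly_dual F) (w p : {poly F}).

Definition Dform u p : F := - u p^`().

Fact Dform_is_linear u : scalable_for *%R (Dform u) * zmod_morphism (Dform u).
Proof.
split=> [c p | p q]; first by rewrite /Dform derivZ linearZ mulrN.
by rewrite /Dform derivB linearB opprD.
Qed.

HB.instance Definition _ u :=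
  GRing.isZmodMorphism.Build {poly F} F (Dform u) (Dform_is_linear u).2.
HB.instance Definition _ u :=
  GRing.isScalable.Build F {poly F} F *%R (Dform u) (Dform_is_linear u).1.

Definition vform n := 'I_n -> poly_dual F.

(* Entry i of M U, where <w u, p> = <u, w p> for a polynomial w. *)
Definition mulmx_form n (M : 'M[{poly F}]_n) (U : vform n) (i : 'I_n) p : F :=
  \sum_j U j (M i j * p).

Fact mulmx_form_is_linear n M U (i : 'I_n) :
  scalable_for *%R (mulmx_form M U i) * zmod_morphism (mulmx_form M U i).
Proof.
split=> [c p | p q]; rewrite /mulmx_form.
  by rewrite mulr_sumr; apply: eq_bigr => j _; rewrite -scalerAr linearZ.
by rewrite -sumrB; apply: eq_bigr => j _; rewrite mulrBr linearB.
Qed.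

HB.instance Definition _ n M U (i : 'I_n) := GRing.isZmodMorphism.Build
  {poly F} F (mulmx_form M U i) (mulmx_form_is_linear M U i).2.
HB.instance Definition _ n M U (i : 'I_n) := GRing.isScalable.Build
  F {poly F} F *%R (mulmx_form M U i) (mulmx_form_is_linear M U i).1.

Definition vmul n (M : 'M[{poly F}]_n) (U : vform n) : vform n :=
  fun i => mulmx_form M U i.

Definition vD n (U : vform n) : vform n := fun i => Dform (U i).

Definition vform2 (u0 u1 : poly_dual F) : vform 2 :=
  fun i => if i == 0 then u0 else u1.

Definition mx2 (a b c d : {poly F}) : 'M[{poly F}]_2 :=
  \matrix_(i, j) if i == 0 then (if j == 0 then a else b)
                 else (if j == 0 then c else d).

End Forms.

Section TwoOrthogonality.
Variable F : numFieldType.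
Implicit Types (P : nat -> {poly F}) (u : nat -> poly_dual F).

Definition MPS P := forall n, P n \is monic /\ size (P n) = n.+1.

Definition dual_seq u P := forall n m, u n (P m) = (n == m)%:R.

Definition two_orthogonal_wrt (u0 u1 : poly_dual F) P :=
  forall nu : nat, (nu < 2)%N ->
  let u := if nu == 0%N then u0 else u1 in
  forall m : nat,
    (forall n : nat, (2 * m + nu + 1 <= n)%N -> u (P m * P n) = 0)
    /\ u (P m * P (2 * m + nu)%N) != 0.

(* The dual sequence of an MPS exists and is unique. *)
Definition two_orthogonal P :=
  MPS P /\ exists2 u, dual_seq u P & two_orthogonal_wrt (u 0%N) (u 1%N) P.

(* The values alpha 0 and gamma 0 play no role. *)
Definition recurrence_coefs (beta alpha gamma : nat -> F) P :=
  [/\ forall n, gamma n.+1 != 0,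
      P 0%N = 1,
      P 1%N = 'X - (beta 0%N)%:P,
      P 2%N = ('X - (beta 1%N)%:P) * P 1%N - (alpha 1%N)%:P
    & forall n, P n.+3 = ('X - (beta n.+2)%:P) * P n.+2
                         - alpha n.+2 *: P n.+1 - gamma n.+1 *: P n].

Definition hahn_classical P :=
  two_orthogonal P /\
  two_orthogonal (fun n => n.+1%:R^-1 *: (P n.+1)^`()).

End TwoOrthogonality.

Section Operator.
Variable F : numFieldType.
Implicit Types p q : {poly F}.

Definition Jop (a0 a1 a2 a3 p : {poly F}) : {poly F} :=
  a0 * p + a1 * p^`() + (2%:R^-1 *: a2) * p^`(2)
  + ((3`!)%:R^-1 *: a3) * p^`(3).

(* The coefficient of X^mu in a_mu is zero for mu >= 4 by the default of nth. *)
Definition lambda0 (a0 a1 a2 a3 : {poly F}) (n : nat) : F :=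
  \sum_(mu < n.+1) ('C(n, mu))%:R * ([:: a0; a1; a2; a3]`_mu)`_mu.

Lemma coef_mul_derivn (a p : {poly F}) k m :
  (size a <= k.+1)%N -> (size p <= m.+1)%N ->
  (a * p^`(k))`_m = a`_k * p`_m *+ m ^_ k.
Proof.
move=> sa sp; rewrite coefM.
have z (j : nat) : (j <= m)%N -> j != k -> a`_j * p^`(k)`_(m - j) = 0.
  move=> jm; rewrite neq_ltn => /orP[jk | kj]; last first.
    by rewrite nth_default ?mul0r // (leq_trans sa).
  rewrite coef_derivn (@nth_default _ _ p) ?mul0rn ?mulr0 //.
  by rewrite (leq_trans sp) // addnBA // ltn_subRL ltn_add2r.
have [km | mk] := ltnP m k.
  rewrite ffact_small // mulr0n big1 // => j _.
  by rewrite z ?neq_ltn ?(leq_trans _ km) // -ltnS.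
rewrite (bigD1 (Ordinal (mk : (k < m.+1)%N))) //= big1 ?addr0.
  by rewrite coef_derivn subnKC // mulrnAr.
by move=> j jk; rewrite z // -ltnS.
Qed.

Section JopTheory.
Variables (a0 a1 a2 a3 : {poly F}).
Hypotheses (s0 : (size a0 <= 1)%N) (s1 : (size a1 <= 2)%N).
Hypotheses (s2 : (size a2 <= 3)%N) (s3 : (size a3 <= 4)%N).
Let J := Jop a0 a1 a2 a3.
Let lam := lambda0 a0 a1 a2 a3.

Lemma coef_Jop p m : (size p <= m.+1)%N -> (J p)`_m = lam m * p`_m.
Proof.
move=> sp; rewrite /J /Jop -!scalerAl -[a0 * p]/(a0 * p^`(0)) -[p^`()]/(p^`(1)).
rewrite !coefD !coefZ !coef_mul_derivn //.
have -> : lam m = \sum_(0 <= mu < 4)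
    ('C(m, mu))%:R * ([:: a0; a1; a2; a3]`_mu)`_mu.
  transitivity (\sum_(0 <= mu < m.+1 + 4)
    ('C(m, mu))%:R * ([:: a0; a1; a2; a3]`_mu)`_mu).
    rewrite (big_cat_nat (n := m.+1)) ?leq_addr //= big_mkord.
    rewrite [X in _ + X]big_nat [X in _ + X]big1 ?addr0 // => i /andP[mi _].
    by rewrite bin_small // mul0r.
  rewrite (big_cat_nat (n := 4)) ?leq_addl //=.
  rewrite [X in _ + X]big_nat [X in _ + X]big1 ?addr0 // => i /andP[mi _].
  have -> : [:: a0; a1; a2; a3]`_i = 0 by rewrite nth_default.
  by rewrite coef0 mulr0.
have fE k : (m ^_ k)%:R = ('C(m, k))%:R * (k`!)%:R :> F.
  by rewrite -natrM bin_ffact.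
rewrite !big_nat_recl // big_geq //= addr0.
rewrite -(mulr_natl _ (m ^_ 0)) -(mulr_natl _ (m ^_ 1)).
rewrite -(mulr_natl _ (m ^_ 2)) -(mulr_natl _ (m ^_ 3)) !fE.
by rewrite fact0 !factS fact0 !muln1; field.
Qed.

Lemma size_Jop p : (size (J p) <= size p)%N.
Proof.
apply/leq_sizeP => j sj.
by rewrite coef_Jop ?nth_default ?mulr0 // leqW.
Qed.

Fact JopB p q : J (p - q) = J p - J q.
Proof. by rewrite /J /Jop derivB !derivnB; ring. Qed.

Fact Jop_inj : (forall n, lam n != 0) -> injective J.
Proof.
move=> lam0 p q Jpq; apply/eqP; rewrite -subr_eq0; apply/negPn/negP => d0.
have := coef_Jop (leqSpred (size (p - q))).
rewrite JopB Jpq subrr coef0 => /esym/eqP; rewrite mulf_eq0 (negPf (lam0 _)).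
by rewrite -/(lead_coef (p - q)) lead_coef_eq0 (negPf d0).
Qed.

Fact Jop_surj n : (forall k, (k < n)%N -> lam k != 0) ->
  forall q, (size q <= n)%N -> exists2 p : {poly F}, (size p <= n)%N & J p = q.
Proof.
elim: n => [|n IH] lam0 q sq.
  exists 0; first by rewrite size_poly0.
  move: sq; rewrite leqn0 size_poly_eq0 => /eqP ->.
  by have := JopB 0 0; rewrite !subrr.
pose c := q`_n / lam n.
have ln : lam n != 0 by exact: lam0.
have sX : (size (c *: 'X^n) <= n.+1)%N.
  by rewrite (leq_trans (size_scale_leq _ _)) // size_polyXn.
have [||p sp Jp] := IH _ (q - J (c *: 'X^n)).
- by move=> k kn; apply: lam0; rewrite ltnW.
- apply/leq_sizeP => j; rewrite leq_eqVlt => /predU1P[<-|nj].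
    by rewrite coefB coef_Jop // coefZ coefXn eqxx mulr1 mulrC divfK // subrr.
  rewrite nth_default // (leq_trans _ nj) // (leq_trans (size_polyD _ _)) //.
  by rewrite size_polyN geq_max sq (leq_trans (size_Jop _)).
exists (p + c *: 'X^n).
  by rewrite (leq_trans (size_polyD _ _)) // geq_max sX andbT leqW.
rewrite -[RHS](subrK (J (c *: 'X^n))) -Jp.
by rewrite -[X in J X + _](addrK (c *: 'X^n) p) JopB subrK.
Qed.

Lemma Jop_bijectiveP : bijective J <-> forall n, lam n != 0.
Proof.
split=> [/bij_inj injJ | lam0].
  elim/ltn_ind => n IH; apply/eqP => ln0.
  have [||p sp Jp] := @Jop_surj n _ (J 'X^n) => //.
    apply/leq_sizeP => j; rewrite leq_eqVlt => /predU1P[<-|nj].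
      by rewrite coef_Jop ?size_polyXn // ln0 mul0r.
    by rewrite nth_default // (leq_trans (size_Jop _)) // size_polyXn.
  by move: sp; rewrite (injJ _ _ Jp) size_polyXn ltnn.
have ex q : exists p : {poly F}, J p == q.
  by have [p _ <-] := Jop_surj (fun k _ => lam0 k) (leqnn (size q)); exists p.
exists (fun q => xchoose (ex q)) => [p | q]; last exact/eqP/(xchooseP (ex q)).
exact/(Jop_inj lam0)/eqP/(xchooseP (ex (J p))).
Qed.

End JopTheory.
End Operator.

Section Coefficients.
Variables (F : numFieldType) (beta alpha gamma : nat -> F).
Variables (tau : F) (a2 : {poly F}).

Let b0 := beta 0%N.
Let b1 := beta 1%N.
Let b2 := beta 2%N.
Let b3 := beta 3%N.
Let al1 := alpha 1%N.
Let al2 := alpha 2%N.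
Let al3 := alpha 3%N.
Let g1 := gamma 1%N.
Let g2 := gamma 2%N.
(* The coefficients written a_0^[2] and a_1^[2]. *)
Let a02 := a2`_0.
Let a12 := a2`_1.

Definition psiE1 : {poly F} := g1^-1 *: ('X - b0%:P).

Definition psiA0 : {poly F} := (- (al1 / g1))%:P.

Definition Psi := mx2 0 1 (2 *: psiE1) (2 *: psiA0).

Definition varpi11 : {poly F} :=
  ((3 * b0 * g2 + al2 * b0 * (b1 + b2 - 2 * (b3 + tau))
    + g1 * (- 2 * b0 - 3 * b1 + 2 * b3 + 6 * tau)) / (6 * g1 * tau))%:P
  + ((3 * (g1 - g2) - al2 * (b1 + b2 - 2 * (b3 + tau))) / (6 * g1 * tau)) *: 'X.

Definition varpi12 : {poly F} :=
  ((g1 * (3 * g1 * a02 - 2 * (al2 + 2 * b0 * tau + b1 * (b1 - b3 - 2 * tau)))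
    + al1 * (- g1 + 3 * g2 + al2 * (b1 + b2 - 2 * (b3 + tau))))
   / (6 * g1 * tau))%:P
  + ((3 * g1 * a12 + 2 * b1 - 2 * b3) / (6 * tau)) *: 'X.

Definition varpi21 : {poly F} :=
  ((9 * g1 ^+ 2 * g2 * tau)^-1
   * (- 3 * al1 * b0 * g2 ^+ 2
      + g2 * g1 * (al1 * (2 * b0 - 2 * b3 + 3 * (b1 + tau))
                   + 6 * b0 * (b0 - b2) * tau)
      + al2 * b0 * (3 * al3 * g1 * tau
                    - al1 * g2 * (b1 + b2 - 2 * b3 + tau))
      - 3 * al3 * g1 ^+ 2 * tau))%:P
  + ((al2 * (al1 * g2 * (b1 + b2 - 2 * b3 + tau) - 3 * al3 * g1 * tau)
      + 3 * g2 * (al1 * (g2 - g1) + 2 * (b2 - b0) * g1 * tau))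
     / (9 * g1 ^+ 2 * g2 * tau)) *: 'X.

Definition varpi22 : {poly F} :=
  ((9 * g1 ^+ 2 * g2 * tau)^-1
   * (al1 * g1 * (g2 * (- 3 * g1 * a02 + 7 * b0 * tau
                        + 2 * (b1 ^+ 2 + b1 * (tau - b3) - 3 * b2 * tau))
                  + al2 * (2 * g2 + 3 * al3 * tau))
      - al1 ^+ 2 * g2 * (- g1 + 3 * g2 + al2 * (b1 + b2 - 2 * b3 + tau))
      - 3 * g1 ^+ 2 * tau * (al3 * b1 - 3 * g2)))%:P
  + ((3 * al3 * g1 * tau
      - al1 * g2 * (3 * g1 * a12 + 2 * b1 - 2 * b3 + 3 * tau))
     / (9 * g1 * g2 * tau)) *: 'X.

Definition Phi := mx2 varpi11 varpi12 varpi21 varpi22.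

End Coefficients.

(* Main.v *)
Require Import Defs.
From mathcomp Require Import all_boot all_order all_algebra reals complex.
From mathcomp Require Import ring.
Import Order.TTheory GRing.Theory Num.Theory.
Local Open Scope ring_scope.

(** Write b for beta_0 and g for gamma_1, and expand everything in powers of
    x - b.  Since a_0 is constant, lambda_n = a_0 - n / (3 g), and the
    eigenvalue equation for P_n becomes, with E + D (x - b) for the polynomial
    (3 g / 2) a_2,
      - (x - b) P_n' + (E + D (x - b)) (P_n'' + (tau / 3) P_n''') = - n P_n.
    It determines the coefficients of P_n one after the other, starting from
    the leading one.  Comparing with the four-term recurrence for n <= 4
    expresses the recurrence coefficients of low index in terms of D, E and tau,
    and leaves two conditions.  The constant term of P_3 gives
    gamma_1 = (2/3) tau E, that is tau a_2(b) = 1.  The constant term of P_4 is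
    3 E^2 - 18 E D^2 + 8 E D tau by the differential equation and
    3 E^2 - 18 E D^2 + 7 E D tau by the recurrence, so E D tau = 0, and D = 0
    because gamma_1 <> 0 ([low_order_elimination]).

    Hence a_2 = 1 / tau is constant.  Then a_0, a_2 and a_3 are constants, so
    differentiation commutes with J up to the shift of the eigenvalue by the
    slope of a_1, and P_{n+1}' is an eigenvector for lambda_n.  Eigenvalues are
    pairwise distinct, whence P_{n+1}' = (n+1) P_n ([eigen_Appell]): the sequence
    is Appell, so its normalized derivatives are the P_n themselves and
    classicality is immediate.

    On the dual side the Appell property reads D u_k = - (k+1) u_{k+1}.  The
    low-order coefficients turn the given Phi into the identity matrix
    ([Phi_eq1]), and the vector equation reduces to D u_0 + u_1 = 0 and
    D u_1 + (2 / g) ((x - b) u_0 - alpha_1 u_1) = 0.  The second one holds because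
    (x - b) u_0 = alpha_1 u_1 + gamma_1 u_2 ([dual0_mulX]). *)

Set Implicit Arguments.
Unset Strict Implicit.

(** * The operator J and polynomial sequences *)

Section PolynomialCoefficients.
Variable F : numFieldType.
Implicit Types (p q : {poly F}).

(** In the basis of powers of the variable centred at the root of a_1, the
    first-order part of J is diagonal, so each coefficient of the image
    involves only coefficients of p of equal or higher index. *)
Lemma coef_shift_Jop (a m c d tau b : F) p k :
  let q := p \Po ('X + b%:P) in
  let w := c%:P + d *: ('X - b%:P) in
  (Jop a%:P (m *: ('X - b%:P)) w (tau *: w) p \Po ('X + b%:P))`_k =
  (a + m * k%:R) * q`_k
  + 2^-1 * (c * (k.+2 * k.+1)%:R * q`_k.+2 + d * (k.+1 * k)%:R * q`_k.+1)
  + tau / 6 * (c * (k.+3 * k.+2 * k.+1)%:R * q`_k.+3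
               + d * (k.+2 * k.+1 * k)%:R * q`_k.+2).
Proof.
move=> q w.
have dq r : (r \Po ('X + b%:P))^`() = r^`() \Po ('X + b%:P).
  by rewrite deriv_comp derivD derivX derivC addr0 mulr1.
have shX : ('X - b%:P) \Po ('X + b%:P) = 'X.
  by rewrite comp_polyB comp_polyX comp_polyC addrK.
have shw : w \Po ('X + b%:P) = c%:P + d *: 'X.
  by rewrite comp_polyD comp_polyC comp_polyZ shX.
rewrite /Jop !comp_polyD !comp_polyM !comp_polyZ shX shw comp_polyC -/q.
have -> : p^`() \Po ('X + b%:P) = q^`() by rewrite dq.
have -> : p^`(2) \Po ('X + b%:P) = q^`()^`() by rewrite !dq.
have -> : p^`(3) \Po ('X + b%:P) = q^`()^`()^`() by rewrite !dq.
have -> : 3`! = 6%N by [].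
rewrite -!scalerAl !mulrDl -!scalerAl !(mulrDl, mul_polyC, scalerDr).
rewrite !(coefD, coefZ, coefXM, coef_deriv).
by case: k => [|k] /=; field.
Qed.

Lemma JopZ (a0 a1 a2 a3 : {poly F}) r p :
  Jop a0 a1 a2 a3 (r *: p) = r *: Jop a0 a1 a2 a3 p.
Proof. by rewrite /Jop derivZ !derivnZ -!scalerAr !scalerDr. Qed.

(** Differentiation commutes with the constant-coefficient part of J; only
    the derivative of a_1 remains. *)
Lemma deriv_Jop (a c d : F) (a1 : {poly F}) p :
  (Jop a%:P a1 c%:P d%:P p)^`()
  = Jop a%:P a1 c%:P d%:P p^`() + a1^`() * p^`().
Proof.
rewrite /Jop -!mul_polyC !derivD.
rewrite !(derivM, derivC, mul0r, mulr0, add0r) -!addrA.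
by congr (_ + _); rewrite [LHS]addrC !addrA.
Qed.

Lemma affine_poly p b : (size p <= 2)%N -> p = p.[b]%:P + p`_1 *: ('X - b%:P).
Proof.
move=> sp; have pE : p = (p`_0)%:P + p`_1 *: 'X.
  apply/polyP => -[|[|k]]; rewrite !coefE /= ?mulr1 ?mulr0 ?addr0 ?add0r //.
  by rewrite nth_default // (leq_trans sp).
have pb : p.[b] = p`_0 + p`_1 * b by rewrite {1}pE !hornerE.
by rewrite pb {1}pE scalerBr polyCD scale_polyC addrACA subrr addr0.
Qed.

(** An MPS spans the polynomials, so equalities between forms may be checked
    on it. *)
Lemma MPS_scalar_eq0 (P : nat -> {poly F}) (f : poly_dual F) :
  MPS P -> (forall n, f (P n) = 0) -> forall p, f p = 0.
Proof.
move=> mpsP fP p; have [n] := ubnP (size p); elim: n p => // n IH p sp.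
have [-> | p0] := eqVneq p 0; first by rewrite linear0.
have [/monicP lP szP] := mpsP (size p).-1.
have p_gt0 : (0 < size p)%N by rewrite size_poly_gt0.
have fE : f p = f (p - lead_coef p *: P (size p).-1).
  by rewrite linearB linearZ /= fP mulr0 subr0.
rewrite fE IH //; rewrite -(prednK p_gt0) ltnS in sp.
rewrite (leq_ltn_trans _ sp) //; apply/leq_sizeP => j.
rewrite leq_eqVlt => /predU1P[<-|lt_j]; rewrite coefB coefZ.
  by move: lP; rewrite lead_coefE szP /= => ->; rewrite mulr1 subrr.
by rewrite !nth_default ?mulr0 ?subrr ?szP // -(prednK p_gt0).
Qed.

(** * Elimination of the low-order coefficients *)

(** Solves a linear equation l = 0 for x: the factor r is the inverse of the
    coefficient of x in l. *)
Lemma eq_lincomb (r l x y : F) : l = 0 -> x - y = r * l -> x = y.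
Proof. by move=> ->; rewrite mulr0 => /eqP; rewrite subr_eq0 => /eqP. Qed.

(** The hypotheses are the eigenvalue equation for P_2, P_3 and P_4, from the
    highest nontrivial coefficient down, after the coefficients of these
    polynomials have been replaced by their values from the recurrence; e_i
    stands for beta_i - beta_0.  All but the last are linear in a new unknown,
    and solving them in this order turns the last one into t E D = 0. *)
Lemma low_order_elimination (E D t e1 e2 e3 al1 al2 al3 g1 g2 : F) :
  (2 - 1) * - e1 + D * (2 * 1)%:R = 0 ->
  2 * - al1 + 0 * - e1 + E * (2 * 1)%:R = 0 ->
  (3 - 2) * (- e1 - e2) + D * (3 * 2)%:R = 0 ->
  (3 - 1) * (- al1 - e2 * - e1 - al2) + D * (2 * 1)%:R * (- e1 - e2)
    + (E * (3 * 2)%:R + t / 3 * D * (3 * 2 * 1)%:R) = 0 ->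
  3 * (- (e2 * - al1) - g1) + 0 * (- al1 - e2 * - e1 - al2)
    + E * (2 * 1)%:R * (- e1 - e2) + t / 3 * E * (3 * 2 * 1)%:R = 0 ->
  (4 - 3) * (- e1 - e2 - e3) + D * (4 * 3)%:R = 0 ->
  (4 - 2) * (- al1 - e2 * - e1 - al2 - e3 * (- e1 - e2) - al3)
    + D * (3 * 2)%:R * (- e1 - e2 - e3)
    + (E * (4 * 3)%:R + t / 3 * D * (4 * 3 * 2)%:R) = 0 ->
  (4 - 1) * (- (e2 * - al1) - g1 - e3 * (- al1 - e2 * - e1 - al2)
             - al3 * - e1 - g2)
    + D * (2 * 1)%:R * (- al1 - e2 * - e1 - al2 - e3 * (- e1 - e2) - al3)
    + (E * (3 * 2)%:R + t / 3 * D * (3 * 2 * 1)%:R) * (- e1 - e2 - e3)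
    + t / 3 * E * (4 * 3 * 2)%:R = 0 ->
  4 * (- (e3 * (- (e2 * - al1) - g1)) - al3 * - al1)
    + 0 * (- (e2 * - al1) - g1 - e3 * (- al1 - e2 * - e1 - al2)
           - al3 * - e1 - g2)
    + E * (2 * 1)%:R * (- al1 - e2 * - e1 - al2 - e3 * (- e1 - e2) - al3)
    + t / 3 * E * (3 * 2 * 1)%:R * (- e1 - e2 - e3) = 0 ->
  g1 != 0 ->
  [/\ D = 0, al1 = E & g1 = 2 / 3 * t * E] /\
  [/\ [/\ e1 = 0, e2 = 0 & e3 = 0], al2 = 2 * E, al3 = 3 * E & g2 = 3 * g1].
Proof.
move=> /(@eq_lincomb (-1) _ e1 (2 * D)) -> //; last by ring.
move=> /(@eq_lincomb (- 2^-1) _ al1 E) ->; last by field.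
move=> /(@eq_lincomb (-1) _ e2 (4 * D)) -> //; last by ring.
move=> /(@eq_lincomb (- 2^-1) _ al2 (2 * E + 2 * D ^+ 2 + t * D)) ->;
  last by field.
move=> /(@eq_lincomb (- 3^-1) _ g1 (2 / 3 * t * E)) ->; last by field.
move=> /(@eq_lincomb (-1) _ e3 (6 * D)) -> //; last by ring.
move=> /(@eq_lincomb (- 2^-1) _ al3 (3 * E + 6 * D ^+ 2 + 3 * t * D)) ->;
  last by field.
move=> /(@eq_lincomb (- 3^-1) _ g2 (2 * t * E + 4 / 3 * t * D ^+ 2)) ->;
  last by field.
(* On the values just found the last hypothesis is - 4 t E D = 0. *)
move=> /(@eq_lincomb (- 6^-1) _ (2 / 3 * t * E * D) 0) ED g1_neq0.
have D0 : D = 0.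
  by apply: (mulfI g1_neq0); rewrite mulr0; apply: ED; field.
by rewrite D0; do !split => //; field.
Qed.

End PolynomialCoefficients.

(** * Determination of the eigenpolynomials *)

Section Classification.
Variables (F : numFieldType) (a0 a1 a2 a3 : {poly F}) (P : nat -> {poly F}).
Variables (beta alpha gamma : nat -> F) (tau : F).
Let b := beta 0%N.
Let g := gamma 1%N.
Hypotheses (size_a0 : (size a0 <= 1)%N) (size_a2 : (size a2 <= 2)%N).
Hypotheses (a1_eq : a1 = - (3 * g)^-1 *: ('X - b%:P)) (a3_eq : a3 = tau *: a2).
Hypotheses (P_mps : MPS P) (P_rec : recurrence_coefs beta alpha gamma P).
Hypothesis J_eigen :
  forall n, Jop a0 a1 a2 a3 (P n) = lambda0 a0 a1 a2 a3 n *: P n.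

Let c := a2.[b].
Let d := a2`_1.
Let q n := P n \Po ('X + b%:P).

Let g_neq0 : g != 0. Proof. by case: P_rec => + *; apply. Qed.

Let q_lead n : (q n)`_n = 1 /\ forall k, (n < k)%N -> (q n)`_k = 0.
Proof.
have [/monicP lP szP] := P_mps n.
have sX : size ('X + b%:P) = 2%N by rewrite size_XaddC.
have szq : size (q n) = n.+1 by rewrite size_comp_poly2.
split=> [|k nk]; last by rewrite nth_default // szq.
have := @lead_coef_comp F (P n) ('X + b%:P).
by rewrite sX lead_coefXaddC expr1n mulr1 lP lead_coefE szq /= => ->.
Qed.

Let J_coef n k :
  lambda0 a0 a1 a2 a3 n * (q n)`_k =
  (a0`_0 - (3 * g)^-1 * k%:R) * (q n)`_k
  + 2^-1 * (c * (k.+2 * k.+1)%:R * (q n)`_k.+2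
            + d * (k.+1 * k)%:R * (q n)`_k.+1)
  + tau / 6 * (c * (k.+3 * k.+2 * k.+1)%:R * (q n)`_k.+3
               + d * (k.+2 * k.+1 * k)%:R * (q n)`_k.+2).
Proof.
have := coef_shift_Jop a0`_0 (- (3 * g)^-1) c d tau b (P n) k.
cbv zeta; rewrite -(affine_poly b size_a2) -size1_polyC // -a1_eq -a3_eq.
by rewrite J_eigen comp_polyZ coefZ mulNr.
Qed.

(** The leading coefficient of the eigenvalue equation. *)
Lemma eigenvalueE n : lambda0 a0 a1 a2 a3 n = a0`_0 - n%:R / (3 * g).
Proof.
have [qn qk] := q_lead n.
have := J_coef n n; rewrite qn !qk ?ltnS ?leqW ?leqnSn // !mulr1.
by rewrite !(mulr0, addr0) mulrC => ->.
Qed.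

(** E + D (x - b) is the polynomial (3 g / 2) a_2; multiplying the equation by
    3 g makes its eigenvalues the integers - n. *)
Let E := 3 * g / 2 * c.
Let D := 3 * g / 2 * d.

Let eigen_coef n k :
  (n%:R - k%:R) * (q n)`_k
  + D * (k.+1 * k)%:R * (q n)`_k.+1
  + (E * (k.+2 * k.+1)%:R + tau / 3 * D * (k.+2 * k.+1 * k)%:R) * (q n)`_k.+2
  + tau / 3 * E * (k.+3 * k.+2 * k.+1)%:R * (q n)`_k.+3 = 0.
Proof.
have := J_coef n k; rewrite eigenvalueE => /eqP; rewrite -subr_eq0 => /eqP.
move/(congr1 ( *%R (- (3 * g)))); rewrite mulr0; apply: etrans.
by rewrite /E /D; field.
Qed.

Lemma a2_and_low_order_coefs : tau != 0 ->
  [/\ a2 = (tau^-1)%:P & 2 * tau * alpha 1%N = 3 * gamma 1%N] /\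
  [/\ forall i, (i < 4)%N -> beta i = beta 0%N,
      alpha 2%N = 2 * alpha 1%N, alpha 3%N = 3 * alpha 1%N
    & gamma 2%N = 3 * gamma 1%N].
Proof.
move=> tau_neq0.
have [_ P0 P1 P2 P3] := P_rec.
have qC r : r%:P \Po ('X + b%:P) = r%:P by rewrite comp_polyC.
pose e n := beta n - b.
have shX r : ('X - r%:P) \Po ('X + b%:P) = 'X - (r - b)%:P.
  by rewrite comp_polyB comp_polyX qC polyCB; ring.
have q0 : q 0%N = 1 by rewrite /q P0 qC.
have q1 : q 1%N = 'X by rewrite /q P1 shX subrr subr0.
have q2 : q 2%N = 'X * 'X - e 1%N *: 'X - (alpha 1%N)%:P.
  rewrite /q P2 comp_polyB comp_polyM shX qC -[P 1%N \Po _]/(q 1%N) q1.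
  by rewrite mulrBl mul_polyC.
have q3 n k : (q n.+3)`_k = (if k == 0%N then 0 else (q n.+2)`_k.-1)
    - e n.+2 * (q n.+2)`_k - alpha n.+2 * (q n.+1)`_k - gamma n.+1 * (q n)`_k.
  have -> : q n.+3 = 'X * q n.+2 - e n.+2 *: q n.+2
                     - alpha n.+2 *: q n.+1 - gamma n.+1 *: q n.
    by rewrite -mul_polyC -mulrBl /q P3 !comp_polyB comp_polyM shX !comp_polyZ.
  by rewrite !(coefB, coefZ, coefXM).
have q21 : (q 2%N)`_1 = - e 1%N by rewrite q2 !coefE /=; ring.
have q20 : (q 2%N)`_0 = - alpha 1%N by rewrite q2 !coefE /=; ring.
have q10 : (q 1%N)`_0 = 0 by rewrite q1 coefX.
have qn n := (q_lead n).1; have qk n := (q_lead n).2.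
have := eigen_coef 2 1; have := eigen_coef 2 0.
have := eigen_coef 3 2; have := eigen_coef 3 1; have := eigen_coef 3 0.
have := eigen_coef 4 3; have := eigen_coef 4 2; have := eigen_coef 4 1.
have := eigen_coef 4 0.
rewrite !q3 /= !qn !q20 !q21 !q10 !qk //.
rewrite !(mulr0, addr0, subr0, sub0r, mulr1) -/g.
move=> H40 H41 H42 H43 H30 H31 H32 H20 H21.
have [] := low_order_elimination H21 H20 H32 H31 H30 H43 H42 H41 H40 g_neq0.
move=> [/eqP + a1E gE] [[e1 e2 e3] -> -> ->].
have h0 : 3 * g / 2 != 0 by rewrite !mulf_neq0 ?invr_eq0 ?pnatr_eq0.
rewrite mulf_eq0 (negPf h0) => /eqP d0.
have c_tau : c * tau = 1.
  apply: (mulfI h0); rewrite mulr1.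
  by transitivity (3 / 2 * (2 / 3 * tau * E)); [rewrite /E | rewrite -gE]; field.
split; split=> //.
- rewrite (affine_poly b size_a2) -/c -/d d0 scale0r addr0.
  by congr _%:P; rewrite -[c](mulfK tau_neq0) c_tau mul1r.
- by rewrite a1E -/g [RHS](congr1 ( *%R 3) gE); field.
- by case=> [|[|[|[|i]]]] // _; apply/eqP; rewrite -subr_eq0; apply/eqP.
- by rewrite a1E.
- by rewrite a1E.
Qed.

(** Both P_{n+1}' and (n+1) P_n are eigenvectors for lambda_n with the same
    leading term, so their difference would be an eigenvector of degree less
    than n; the eigenvalue of such a vector is the one attached to its
    degree, and these are pairwise distinct. *)
Lemma eigen_Appell n :
  a2 = (tau^-1)%:P -> (P n.+1)^`() = n.+1%:R *: P n.
Proof.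
move=> a2E; set J := Jop a0 a1 a2 a3; pose lam := lambda0 a0 a1 a2 a3.
have size_a1 : (size a1 <= 2)%N.
  by rewrite a1_eq (leq_trans (size_scale_leq _ _)) // size_XsubC.
have size_a3 : (size a3 <= 4)%N.
  by rewrite a3_eq (leq_trans (size_scale_leq _ _)) // (leq_trans size_a2).
have JD : J (P n.+1)^`() = lam n *: (P n.+1)^`().
  have := deriv_Jop a0`_0 tau^-1 (tau / tau) a1 (P n.+1).
  have <- : a3 = (tau / tau)%:P by rewrite a3_eq a2E -mul_polyC -polyCM.
  rewrite -size1_polyC // -a2E J_eigen derivZ -/J => /eqP.
  have -> : a1^`() = (- (3 * g)^-1)%:P.
    by rewrite a1_eq derivZ derivXsubC alg_polyC.
  rewrite -subr_eq => /eqP <-; rewrite mul_polyC -scalerBl.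
  by congr (_ *: _); rewrite /lam !eigenvalueE opprK; field.
set W := (P n.+1)^`() - n.+1%:R *: P n.
have JW : J W = lam n *: W.
  by rewrite /J JopB JopZ J_eigen -/J JD scalerBr !scalerA mulrC.
have [_ szP] := P_mps n; have [mP' szP'] := P_mps n.+1.
have sW : (size W <= n)%N.
  apply/leq_sizeP => j; rewrite leq_eqVlt coefB coef_deriv coefZ.
  case/predU1P=> [<-|nj]; last first.
    by rewrite !nth_default ?szP ?szP' // mul0rn mulr0 subrr.
  have /monicP := (P_mps n).1; have /monicP := mP'.
  by rewrite !lead_coefE szP szP' /= => -> ->; rewrite mulr1 subrr.
apply/eqP; rewrite -subr_eq0 -/W; apply/negPn/negP => W0.
have := coef_Jop size_a0 size_a1 (leqW size_a2) size_a3 (leqSpred (size W)).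
rewrite -/J JW coefZ -lead_coefE => /mulIf.
rewrite lead_coef_eq0 => /(_ W0) /eqP; rewrite /lam !eigenvalueE.
move/eqP; have h0 : (3 * g)^-1 != 0 by rewrite invr_eq0 mulf_neq0 ?pnatr_eq0.
move/addrI/oppr_inj/(mulIf h0)/eqP; rewrite eqr_nat => /eqP nE.
by move: sW; rewrite nE leqNgt prednK ?leqnn // size_poly_gt0.
Qed.

End Classification.

(** * Appell sequences and the vector functional equation *)

Section VectorForm.
Variables (F : numFieldType) (P : nat -> {poly F}) (u : nat -> poly_dual F).
Variables (beta alpha gamma : nat -> F) (tau : F) (a2 : {poly F}).
Hypotheses (P_mps : MPS P) (u_dual : dual_seq u P).
Hypothesis P_rec : recurrence_coefs beta alpha gamma P.
Hypothesis P_Appell : forall n, (P n.+1)^`() = n.+1%:R *: P n.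

Lemma hahn_classical_Appell : two_orthogonal P -> hahn_classical P.
Proof.
move=> orthP; split=> //; have [_ [v v_dual v_orth]] := orthP.
have PE n : n.+1%:R^-1 *: (P n.+1)^`() = P n.
  by rewrite P_Appell scalerA mulVf ?scale1r ?pnatr_eq0.
split=> [n|]; first by rewrite PE.
exists v => [n m|nu nu2 w m]; first by rewrite PE v_dual.
have [z nz] := v_orth nu nu2 m; rewrite -/w in z nz.
by split=> [n mn|]; rewrite !PE // z.
Qed.

(** The form D u_k is - (k+1) u_{k+1}, tested on the basis P_n. *)
Lemma dual_deriv k n : u k (P n)^`() = n%:R * (k.+1 == n)%:R.
Proof.
case: n => [|n]; last by rewrite P_Appell linearZ /= u_dual eqSS.
by have [_ ->] := P_rec; rewrite -polyC1 derivC linear0 mul0r.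
Qed.

(** The form (x - b) u_0 is alpha_1 u_1 + gamma_1 u_2, tested on the basis:
    only the terms of the recurrence that reach P_0 survive. *)
Lemma dual0_mulX n : u 0%N (('X - (beta 0%N)%:P) * P n)
  = alpha 1%N * (n == 1%N)%:R + gamma 1%N * (n == 2%N)%:R.
Proof.
have [_ P0 P1 P2 P3] := P_rec; pose e k := beta k - beta 0%N.
have yP k : ('X - (beta 0%N)%:P) * P k
    = ('X - (beta k)%:P) * P k + e k *: P k.
  by rewrite -mul_polyC -mulrDl polyCB addrA subrK.
have yPSS k : ('X - (beta 0%N)%:P) * P k.+2 = P k.+3 + gamma k.+1 *: P k
    + alpha k.+2 *: P k.+1 + e k.+2 *: P k.+2.
  by rewrite yP P3 !subrK.
case: n => [|[|[|n]]].
- by rewrite P0 mulr1 -P1 u_dual !mulr0 addr0.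
- have -> : ('X - (beta 0%N)%:P) * P 1%N
      = P 2%N + alpha 1%N *: P 0%N + e 1%N *: P 1%N.
    by rewrite yP P2 P0 alg_polyC subrK.
  by rewrite !linearD !linearZ /= !u_dual !(mulr0, add0r, addr0).
- by rewrite yPSS !linearD !linearZ /= !u_dual !(mulr0, add0r, addr0).
by rewrite yPSS !linearD !linearZ /= !u_dual !mulr0 !addr0.
Qed.

(** Each entry of Phi is affine in x with coefficients rational in tau,
    alpha_1 and beta_0 once gamma_1 = (2/3) tau alpha_1 is substituted, and
    the powers of beta_0 cancel. *)
Lemma Phi_eq1 : tau != 0 -> gamma 1%N != 0 ->
  a2 = (tau^-1)%:P -> 2 * tau * alpha 1%N = 3 * gamma 1%N ->
  (forall i, (i < 4)%N -> beta i = beta 0%N) ->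
  alpha 2%N = 2 * alpha 1%N -> alpha 3%N = 3 * alpha 1%N ->
  gamma 2%N = 3 * gamma 1%N ->
  Phi beta alpha gamma tau a2 = mx2 1 0 0 1.
Proof.
move=> tau_neq0 g_neq0 a2E a1E bE a2_eq a3_eq g2E.
have gE : gamma 1%N = 2 / 3 * tau * alpha 1%N.
  apply: (mulfI (_ : 3 != 0)); first by rewrite pnatr_eq0.
  by rewrite -a1E; field.
have al_neq0 : alpha 1%N != 0.
  by apply: contraNneq g_neq0 => al0; rewrite gE al0 mulr0.
rewrite /Phi /varpi11 /varpi12 /varpi21 /varpi22 a2E !coefC /=.
rewrite !bE // a2_eq a3_eq g2E gE.
have entry (A B r : F) : A = r -> B = 0 -> A%:P + B *: 'X = r%:P :> {poly F}.
  by move=> -> ->; rewrite scale0r addr0.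
have ne := (tau_neq0, al_neq0).
by rewrite -(polyC1 F) -(polyC0 F); congr mx2; apply: entry; field; rewrite ?ne.
Qed.

Lemma vector_equation (U := vform2 (u 0%N) (u 1%N)) :
  Phi beta alpha gamma tau a2 = mx2 1 0 0 1 ->
  forall i p, vD (vmul (Phi beta alpha gamma tau a2) U) i p
              + vmul (Psi beta alpha gamma) U i p = 0.
Proof.
move=> -> i p; have [g_neq0 _ _ _ _] := P_rec.
apply: (@MPS_scalar_eq0 _ _ (vD (vmul (mx2 1 0 0 1) U) i
                             \+ vmul (Psi beta alpha gamma) U i) P_mps) => n /=.
rewrite /vD /vmul /Dform /= /mulmx_form !big_ord_recl !big_ord0 !addr0 !mxE /=.
rewrite /U /vform2 /=; case: (i == 0).
  rewrite !(mul0r, mul1r, linear0, add0r, addr0) dual_deriv u_dual eq_sym.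
  by case: eqP => [->|_]; rewrite !(mulr0, mulr1) addrC subrr.
rewrite !(mul0r, mul1r, linear0, add0r, addr0).
rewrite dual_deriv /psiE1 /psiA0 -!scalerAl mul_polyC !linearZ /=.
rewrite dual0_mulX u_dual.
rewrite [1%N == _]eq_sym [2%N == _]eq_sym.
case: n => [|[|[|n]]] /=; field; exact: g_neq0.
Qed.

End VectorForm.

Unset Implicit Arguments.

Theorem theorem5p1 (R : realType) (a0 a1 a2 a3 : {poly R[i]})
    (P : nat -> {poly R[i]}) (u : nat -> poly_dual R[i])
    (beta alpha gamma : nat -> R[i]) (tau : R[i])
    (size_a0 : (size a0 <= 1)%N) (size_a1 : (size a1 <= 2)%N)
    (size_a2 : (size a2 <= 3)%N) (size_a3 : (size a3 <= 4)%N)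
    (J_iso : forall n : nat, lambda0 a0 a1 a2 a3 n != 0)
    (P_mps : MPS P) (u_dual : dual_seq u P)
    (P_orth : two_orthogonal_wrt (u 0%N) (u 1%N) P)
    (P_rec : recurrence_coefs beta alpha gamma P)
    (alpha4 : alpha 4%N = alpha 2%N * gamma 3%N / gamma 2%N)
    (J_eigen : forall n : nat,
       Jop a0 a1 a2 a3 (P n) = lambda0 a0 a1 a2 a3 n *: P n)
    (a3_eq : a3 = tau *: a2) (tau_neq0 : tau != 0)
    (a1_eq : a1 = - (3 * gamma 1%N)^-1 *: ('X - (beta 0%N)%:P))
    (deg_a2 : (size a2 <= 2)%N)
    (a12_neq : forall m : nat,
       a2`_1 != 2 * tau / (gamma 1%N * (m + 1)%:R)
                - 2 / (3 * gamma 1%N) * (beta 1%N - beta 3%N)) :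
  hahn_classical P /\
  let U := vform2 (u 0%N) (u 1%N) in
  let Phi := Phi beta alpha gamma tau a2 in
  let Psi := Psi beta alpha gamma in
  forall (i : 'I_2) (p : {poly R[i]}),
    vD (vmul Phi U) i p + vmul Psi U i p = 0.
Proof.
have [g_neq0 _ _ _ _] := P_rec.
have [[a2E al1E] [betaE al2E al3E g2E]] :=
  a2_and_low_order_coefs size_a0 deg_a2 a1_eq a3_eq P_mps P_rec J_eigen tau_neq0.
have P_Appell n :=
  eigen_Appell size_a0 deg_a2 a1_eq a3_eq P_mps P_rec J_eigen n a2E.
split; first by apply: hahn_classical_Appell => //; split=> //; exists u.
move=> U Phi' Psi' i p; apply: (@vector_equation _ P) => //.
exact: Phi_eq1.
Qed.
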